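(* Let $D\ge1$ and $|{\bm{V}}|\ge2$ be integers. Let ${\bm{C}}\in\mathbb{R}^{D\times|{\bm{V}}|}$ have spectral norm $\|{\bm{C}}\|_2=\sigma_C$ and let ${\bm{h}}\in\mathbb{R}^D$ satisfy $|h_i|\le\sigma_h$ for all $i$. Set $\rho=\sigma_C\sigma_h$, ${\bm{u}}={\bm{C}}^\top{\bm{h}}\in\mathbb{R}^{|{\bm{V}}|}$, and $$\gamma=\exp\!\Big(-\rho\sqrt{\tfrac{D|{\bm{V}}|}{|{\bm{V}}|-1}}\Big).$$ Let $\mathcal{H}_{{\bm{u}}}=-\sum_{i=1}^{|{\bm{V}}|}p_i\log p_i$ be the entropy of ${\bm{p}}=\mathrm{softmax}({\bm{u}})$, $p_i=e^{u_i}/\sum_j e^{u_j}$. Then $$\mathcal{H}_{{\bm{u}}}\;\ge\;\log\big(1+(|{\bm{V}}|-1)\gamma\big)+\frac{\rho\,\gamma\sqrt{D|{\bm{V}}|(|{\bm{V}}|-1)}}{1+(|{\bm{V}}|-1)\gamma}.$$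
   Context: $\|\cdot\|_2$ is the spectral norm of a matrix; logarithms are natural. ${\bm{C}}$ plays the role of the language-model head (classifier) with hidden size $D$ and vocabulary size $|{\bm{V}}|$, ${\bm{h}}$ the final hidden state, and ${\bm{u}}$ the resulting logits. *)

(* Defs.v *)
From HB Require Import structures.
From mathcomp Require Import all_boot all_order all_algebra.
From mathcomp Require Import all_classical all_reals all_analysis.
Set Implicit Arguments. Unset Strict Implicit. Unset Printing Implicit Defensive.
Import Order.TTheory GRing.Theory Num.Theory.
Local Open Scope classical_set_scope.
Local Open Scope ring_scope.

Definition vnorm2 {R : realType} {n : nat} (v : 'cV[R]_n) : R :=
  Num.sqrt (\sum_(i < n) (v i ord0) ^+ 2).

Definition spec_norm {R : realType} {m n : nat} (C : 'M[R]_(m, n)) : R :=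
  sup [set vnorm2 (C *m x) | x in [set x : 'cV[R]_n | vnorm2 x = 1]].

Definition softmax {R : realType} {n : nat} (u : 'cV[R]_n) (i : 'I_n) : R :=
  expR (u i ord0) / \sum_(j < n) expR (u j ord0).

Definition softmax_entropy {R : realType} {n : nat} (u : 'cV[R]_n) : R :=
  - \sum_(i < n) softmax u i * ln (softmax u i).

(* Main.v *)
Require Import Defs.
From HB Require Import structures.
From mathcomp Require Import all_boot all_order all_algebra.
From mathcomp Require Import all_classical all_reals all_analysis.
From mathcomp Require Import ring lra.
Import Order.TTheory GRing.Theory Num.Theory.
Import numFieldNormedType.Exports.
Set Implicit Arguments.
Unset Strict Implicit.
Unset Printing Implicit Defensive.
Local Open Scope classical_set_scope.
Local Open Scope ring_scope.

(** Let [H] be the entropy of softmax [u], seen as a function of the logits: it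
    is [ln Z - m], with [Z = sum_i e^(u_i)] and [m] the mean of [u] under
    softmax.  Since [|C^T h| <= sigmaC |h| <= rho sqrt D], it suffices to bound
    [H] below on spheres, where it attains its minimum, at [v] say.  Rotating
    [v] in the coordinate plane [(i, j)] leaves [H] stationary, so
    [e^(v_i) (1 - m / v_i)] does not depend on [i]; summing over [j] shows that
    [sum_i v_i = 0] unless [v] is constant (where [H] is maximal).  Then
    [m > 0], and since [x |-> e^x (1 - m / x)] increases both on [x < 0] and on
    [x > m], the negative coordinates agree, and so do those above [m].  Two
    equal coordinates above [m] are impossible, because rotating them apart
    makes the slope negative at once; stationarity then makes all the others
    negative.  Hence [v] is a spike: one coordinate [a] and all others equal to
    [b], with [a - b = |v| sqrt (V / (V - 1))]; the entropy of such a vector is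
    explicit and nonincreasing in [a - b]. *)

Lemma sqrtr_mulr_divr (R : rcfType) (x y : R) : 0 < y ->
  Num.sqrt (x * y) = y * Num.sqrt (x / y).
Proof.
move=> y0; rewrite -[X in X * Num.sqrt _](gtr0_norm y0) -sqrtr_sqr.
by rewrite -sqrtrM ?sqr_ge0 //; congr Num.sqrt; field; rewrite gt_eqF.
Qed.

Lemma cauchy_schwarz_sum (R : realDomainType) (I : finType) (f g : I -> R) :
  (\sum_i f i * g i) ^+ 2 <= (\sum_i f i ^+ 2) * (\sum_i g i ^+ 2).
Proof.
set P := \sum_i f i * g i; set A := \sum_i f i ^+ 2; set B := \sum_i g i ^+ 2.
have [B_eq0|B_neq0] := eqVneq B 0.
  have g_eq0 i : g i = 0.
    have := psumr_eq0P (fun j _ => sqr_ge0 (g j)) B_eq0 (i := i) isT.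
    by move/eqP; rewrite sqrf_eq0 => /eqP.
  by rewrite B_eq0 mulr0 /P big1 ?expr0n // => i _; rewrite g_eq0 mulr0.
have B_gt0 : 0 < B.
  by rewrite lt_neqAle eq_sym B_neq0 sumr_ge0 // => i _; exact: sqr_ge0.
have sum_sqrE (b p : R) : \sum_i (b * f i - p * g i) ^+ 2 =
    b ^+ 2 * (\sum_i f i ^+ 2) - 2 * b * p * (\sum_i f i * g i)
    + p ^+ 2 * (\sum_i g i ^+ 2).
  rewrite !mulr_sumr -sumrB -big_split /=.
  by apply: eq_bigr => i _; ring.
have : 0 <= \sum_i (B * f i - P * g i) ^+ 2.
  by apply: sumr_ge0 => i _; exact: sqr_ge0.
rewrite sum_sqrE -/A -/B -/P.
have -> : B ^+ 2 * A - 2 * B * P * P + P ^+ 2 * B = B * (A * B - P ^+ 2).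
  by ring.
by rewrite pmulr_rge0 // subr_ge0.
Qed.

Lemma is_derive_lt0_near_right (R : realType) (f df : R -> R) (a : R) :
  (forall t : R, is_derive t 1 f (df t)) ->
  (\forall t \near a^'+, df t < 0) ->
  (\forall t \near a^'+, f t < f a).
Proof.
move=> fP [e /= e0 df_lt0].
have f_derivable (t : R) : derivable f t 1 by have [] := fP t.
near=> b.
have ab : a < b by near: b; exact: nbhs_right_gt.
have bae : b < a + e by near: b; apply: nbhs_right_lt; rewrite ltrDl.
apply: (@ltr0_derive1_lt_cc _ f a b) => //.
- move=> t /[!in_itv]/= /andP[at_ tb].
  have dft := fP t; rewrite derive1E derive_val.
  by apply: df_lt0 => //=; rewrite ltr_distl; apply/andP; split; lra.
- exact: derivable_within_continuous.
- by rewrite in_itv /= (ltW ab) lexx.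
- by rewrite in_itv /= (ltW ab) lexx.
Unshelve. all: by end_near. Qed.

Lemma compact_sphere (R : realType) (n : nat) (r : R) :
  compact [set x : 'rV[R]_n | \sum_i x ord0 i ^+ 2 = r].
Proof.
apply: bounded_closed_compact.
  exists (Num.sqrt r); split; first exact: num_real.
  move=> M /ltW rM x /= xr; apply: le_trans rM.
  rewrite /Num.norm /= mx_normrE; apply: bigmax_le; first exact: sqrtr_ge0.
  move=> [a i] _ /=; rewrite (ord1 a) -sqrtr_sqr ler_wsqrtr // -xr.
  by rewrite (bigD1 i) //= lerDl; apply: sumr_ge0 => j _; exact: sqr_ge0.
pose sum_sqr (x : 'rV[R]_n) := \sum_i x ord0 i ^+ 2.
have sum_sqr_continuous : continuous sum_sqr.
  apply: continuous_big => [|i _ x]; first exact: add_continuous.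
  apply: (continuous_comp (g := fun y : R => y ^+ 2)).
    exact: coord_continuous.
  exact: exprn_continuous.
apply: (@preimage_closed _ _ sum_sqr [set r]) => [x _|].
  exact: sum_sqr_continuous.
exact: closed_eq.
Qed.

Section SpectralNorm.
Context {R : realType}.

Lemma vnorm2_ge0 n (x : 'cV[R]_n) : 0 <= vnorm2 x.
Proof. exact: sqrtr_ge0. Qed.

Lemma sqr_vnorm2 n (x : 'cV[R]_n) : vnorm2 x ^+ 2 = \sum_i x i ord0 ^+ 2.
Proof. by rewrite sqr_sqrtr // sumr_ge0 // => i _; exact: sqr_ge0. Qed.

Lemma vnorm2Z n (a : R) (x : 'cV[R]_n) : vnorm2 (a *: x) = `|a| * vnorm2 x.
Proof.
rewrite -sqrtr_sqr /vnorm2 -sqrtrM ?sqr_ge0 // mulr_sumr.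
by congr Num.sqrt; apply: eq_bigr => i _; rewrite mxE exprMn.
Qed.

Lemma vnorm2_eq0 n (x : 'cV[R]_n) : (vnorm2 x == 0) = (x == 0).
Proof.
rewrite -sqrf_eq0 sqr_vnorm2 psumr_eq0 => [|i _]; last exact: sqr_ge0.
apply/allP/eqP => [x0|-> i _]; last by rewrite /= mxE expr0n eqxx.
apply/matrixP => i j; rewrite (ord1 j) mxE; apply/eqP.
by rewrite -sqrf_eq0; exact: x0 (mem_index_enum _).
Qed.

Lemma vnorm20 n : vnorm2 (0 : 'cV[R]_n) = 0.
Proof. by apply/eqP; rewrite vnorm2_eq0. Qed.

Lemma vnorm2_le_entries n (x : 'cV[R]_n) (s : R) :
  (forall i, `|x i ord0| <= s) -> vnorm2 x <= Num.sqrt n%:R * s.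
Proof.
case: n x => [|n] x xs; first by rewrite /vnorm2 big_ord0 sqrtr0 mul0r.
have s0 : 0 <= s by exact: le_trans (xs ord0).
rewrite -[s]ger0_norm // -sqrtr_sqr -sqrtrM // ler_wsqrtr // mulr_natl.
rewrite -[n.+1 in leRHS]card_ord -sumr_const.
by apply: ler_sum => i _; rewrite -real_normK ?num_real // ler_sqr ?nnegrE.
Qed.

Lemma vnorm2_mulmx_le_frobenius m n (A : 'M[R]_(m, n)) (x : 'cV[R]_n) :
  vnorm2 (A *m x) <= Num.sqrt (\sum_i \sum_j A i j ^+ 2) * vnorm2 x.
Proof.
rewrite -sqrtrM; last first.
  by apply: sumr_ge0 => i _; apply: sumr_ge0 => j _; exact: sqr_ge0.
rewrite ler_wsqrtr // mulr_suml; apply: ler_sum => i _; rewrite mxE.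
exact: cauchy_schwarz_sum.
Qed.

Lemma vnorm2_mulmx_le m n (A : 'M[R]_(m, n)) (x : 'cV[R]_n) :
  vnorm2 (A *m x) <= spec_norm A * vnorm2 x.
Proof.
have [->|x_neq0] := eqVneq x 0.
  by rewrite mulmx0 !vnorm20 mulr0.
have x_gt0 : 0 < vnorm2 x.
  by rewrite lt_neqAle eq_sym vnorm2_eq0 x_neq0 vnorm2_ge0.
rewrite -ler_pdivrMr // mulrC -[X in X * _]gtr0_norm ?invr_gt0 // -vnorm2Z.
rewrite scalemxAr; apply: ub_le_sup.
  exists (Num.sqrt (\sum_i \sum_j A i j ^+ 2)) => _ [y /= y1 <-].
  by rewrite -[leRHS]mulr1 -y1; exact: vnorm2_mulmx_le_frobenius.
exists ((vnorm2 x)^-1 *: x) => //=.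
by rewrite vnorm2Z gtr0_norm ?invr_gt0 // mulVf // gt_eqF.
Qed.

Lemma spec_norm_ge0 m n (A : 'M[R]_(m, n)) : 0 <= spec_norm A.
Proof.
rewrite /spec_norm; set S := (X in sup X).
have [->|/set0P[_ [x /= x1 _]]] := eqVneq S set0; first by rewrite sup0.
rewrite (le_trans (vnorm2_ge0 (A *m x))) // -[leRHS]mulr1 -x1.
exact: vnorm2_mulmx_le.
Qed.

Lemma vnorm2_trmx_mulmx_le m n (A : 'M[R]_(m, n)) (y : 'cV[R]_m) :
  vnorm2 (A^T *m y) <= spec_norm A * vnorm2 y.
Proof.
set z := A^T *m y.
have z_sqr : vnorm2 z ^+ 2 = \sum_i y i ord0 * (A *m z) i ord0.
  have dotE k (v w : 'cV[R]_k) :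
      \sum_i v i ord0 * w i ord0 = (v^T *m w) ord0 ord0.
    by rewrite mxE; apply: eq_bigr => i _; rewrite [v^T _ _]mxE.
  rewrite sqr_vnorm2 (eq_bigr _ (fun i _ => expr2 (z i ord0))) !dotE.
  by rewrite [in z^T]/z trmx_mul trmxK mulmxA.
have : vnorm2 z ^+ 2 <= vnorm2 y * (spec_norm A * vnorm2 z).
  apply: (@le_trans _ _ (vnorm2 y * vnorm2 (A *m z))); last first.
    by rewrite ler_wpM2l ?vnorm2_ge0 // vnorm2_mulmx_le.
  rewrite -ler_sqr ?nnegrE ?mulr_ge0 ?sqr_ge0 ?vnorm2_ge0 //.
  by rewrite z_sqr exprMn !sqr_vnorm2 cauchy_schwarz_sum.
have [-> _|z_neq0] := eqVneq (vnorm2 z) 0.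
  by rewrite mulr_ge0 ?spec_norm_ge0 ?vnorm2_ge0.
by rewrite expr2 mulrCA mulrA ler_pM2r // lt_neqAle eq_sym z_neq0 vnorm2_ge0.
Qed.

End SpectralNorm.

Section SpikeEntropy.
Context {R : realType}.
Implicit Types N d : R.

(* The entropy of the softmax of [(d, 0, ..., 0)], with [N] zeros. *)
Definition spike_entropy N d : R :=
  ln (1 + N * expR (- d)) + N * d * expR (- d) / (1 + N * expR (- d)).

Lemma is_derive_spike_entropy N d : 0 <= N ->
  is_derive d 1 (spike_entropy N)
    (- (N * d * expR (- d)) / (1 + N * expR (- d)) ^+ 2).
Proof.
move=> N0; pose q x := 1 + N * expR (- x).
have q_gt0 : 0 < q d by rewrite ltr_wpDr // mulr_ge0 ?expR_ge0.
have dexp : is_derive d 1 (fun x => expR (- x)) (- expR (- d)).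
  by apply: is_derive_eq; rewrite /= /GRing.scale /=; ring.
have dq : is_derive d 1 q (- (N * expR (- d))).
  by apply: is_derive_eq; rewrite /= /GRing.scale /=; ring.
have dln := is_derive1_comp (is_derive1_ln q_gt0) dq.
have dinv := is_deriveV (lt0r_neq0 q_gt0) dq.
have dnum : is_derive d 1 (fun x => N * x * expR (- x))
    (N * expR (- d) - N * d * expR (- d)).
  by apply: is_derive_eq; rewrite /= /GRing.scale /=; ring.
apply: is_derive_eq (is_deriveD dln (is_deriveM dnum dinv)) _.
rewrite /= /GRing.scale /=; move: q_gt0; rewrite /q => q_gt0.
by field; rewrite gt_eqF.
Qed.

Lemma spike_entropy_nonincreasing N x y : 0 <= N -> 0 <= x -> x <= y ->
  spike_entropy N y <= spike_entropy N x.
Proof.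
move=> N0; apply: ler0_derive1_nincry.
- by move=> t _; have [] := is_derive_spike_entropy t N0.
- move=> t; rewrite in_itv /= andbT => t0.
  have df := is_derive_spike_entropy t N0; rewrite derive1E derive_val.
  rewrite mulNr oppr_le0 divr_ge0 ?sqr_ge0 //.
  by rewrite !mulr_ge0 ?expR_ge0 // ltW.
- apply: derivable_within_continuous => t _.
  by have [] := is_derive_spike_entropy t N0.
Qed.

End SpikeEntropy.

Section LogitEntropy.
Context {R : realType} {n : nat}.
Variable i0 : 'I_n.
Implicit Types (u : 'I_n -> R) (i j k : 'I_n).

Definition partition_fun u : R := \sum_i expR (u i).

Definition gibbs_mean u : R := (\sum_i u i * expR (u i)) / partition_fun u.

Definition logit_entropy u : R := ln (partition_fun u) - gibbs_mean u.

Lemma partition_fun_gt0 u : 0 < partition_fun u.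
Proof.
rewrite /partition_fun (bigD1 i0) //= ltr_pwDl ?expR_gt0 //.
by apply: sumr_ge0 => i _; exact: expR_ge0.
Qed.

Lemma softmax_entropyE (v : 'cV[R]_n) :
  softmax_entropy v = logit_entropy (v^~ ord0).
Proof.
have := partition_fun_gt0 (v^~ ord0).
rewrite /softmax_entropy /logit_entropy /gibbs_mean /softmax.
rewrite -/(partition_fun (v^~ ord0)); set Z := partition_fun _ => Z_gt0.
rewrite (eq_bigr (fun i => (v i ord0 * expR (v i ord0)) / Z -
    expR (v i ord0) * (ln Z / Z))) => [|i _]; last first.
  by rewrite ln_div ?posrE ?expR_gt0 // expRK; ring.
rewrite sumrB -!mulr_suml -/(partition_fun (v^~ ord0)) -/Z opprB.
by congr (_ - _); field; rewrite gt_eqF.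
Qed.

Lemma sum_neq_const i (c : R) : \sum_(k | k != i) c = (n%:R - 1) * c.
Proof.
have : \sum_(k < n) c = n%:R * c by rewrite sumr_const card_ord mulr_natl.
by rewrite (bigD1 i) //=; lra.
Qed.

Lemma sum_spike (F : R -> R) u k (b : R) : (forall l, l != k -> u l = b) ->
  \sum_l F (u l) = F (u k) + (n%:R - 1) * F b.
Proof.
move=> ub; rewrite (bigD1 k) //= -(sum_neq_const k); congr (_ + _).
by apply: eq_bigr => l /ub ->.
Qed.

Lemma logit_entropy_spike u k (b : R) : (forall l, l != k -> u l = b) ->
  logit_entropy u = spike_entropy (n%:R - 1) (u k - b).
Proof.
move=> ub; set N := n%:R - 1; pose q := 1 + N * expR (- (u k - b)).
have expb : expR b = expR (u k) * expR (- (u k - b)).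
  by rewrite -expRD; congr expR; ring.
have ZE : partition_fun u = expR (u k) * q.
  by rewrite /partition_fun (sum_spike _ ub) expb /q /N; ring.
have exp_gt0 := expR_gt0 (u k).
have q_gt0 : 0 < q by have := partition_fun_gt0 u; rewrite ZE pmulr_rgt0.
have mE : gibbs_mean u = u k - N * (u k - b) * expR (- (u k - b)) / q.
  rewrite /gibbs_mean ZE (sum_spike (fun x => x * expR x) ub) expb -/N.
  move: q_gt0 exp_gt0; rewrite /q; move: (expR _) (expR _) => x y q_gt0 y_gt0.
  by field; rewrite !gt_eqF.
rewrite /logit_entropy ZE mE lnM ?posrE // expRK /spike_entropy -/q.
by ring.
Qed.

Lemma spike_gapE u k (b : R) : (1 < n)%N -> \sum_l u l = 0 -> b <= u k ->
  (forall l, l != k -> u l = b) ->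
  Num.sqrt (\sum_l u l ^+ 2) * Num.sqrt (n%:R / (n%:R - 1)) = u k - b.
Proof.
move=> n1 sum0 buk ub; have N_gt0 : 0 < n%:R - 1 :> R by rewrite subr_gt0 ltr1n.
have ukE : u k = - ((n%:R - 1) * b).
  by move: sum0; rewrite (sum_spike id ub) /=; lra.
rewrite -sqrtrM ?sumr_ge0 // => [|l _]; last exact: sqr_ge0.
rewrite -[RHS]ger0_norm ?subr_ge0 // -sqrtr_sqr.
rewrite (sum_spike (fun x => x ^+ 2) ub) ukE.
by congr Num.sqrt; field; rewrite gt_eqF.
Qed.

Definition tilt (m x : R) : R := (x - m) * expR x.

Lemma sum_tilt u : \sum_i tilt (gibbs_mean u) (u i) = 0.
Proof.
under eq_bigr do rewrite /tilt mulrBl.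
rewrite sumrB -mulr_sumr -/(partition_fun u).
by rewrite divfK ?subrr // gt_eqF ?partition_fun_gt0.
Qed.

Lemma gibbs_mean_gt0 u i : 0 <= \sum_k u k -> u i != 0 -> 0 < gibbs_mean u.
Proof.
move=> sum_ge0 ui; rewrite divr_gt0 ?partition_fun_gt0 //.
have lt_mul_expR (x : R) : x != 0 -> x < x * expR x.
  rewrite neq_lt => /orP[x0|x0]; first by rewrite ltr_nMr // expR_lt1.
  by rewrite ltr_pMr // expR_gt1.
apply: le_lt_trans sum_ge0 _; rewrite !(bigD1 (P := predT) i) //=.
apply: ltr_leD; first exact: lt_mul_expR.
apply: ler_sum => k _; have [->|/lt_mul_expR/ltW//] := eqVneq (u k) 0.
by rewrite mul0r.
Qed.

Lemma exists_gibbs_mean_lt u i j : u i != u j -> exists k, gibbs_mean u < u k.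
Proof.
move=> uij; set m := gibbs_mean u.
apply/existsP; apply: contraT => /existsPn u_le.
have opp_tilt_ge0 k : 0 <= - tilt m (u k).
  by rewrite oppr_ge0 mulr_le0_ge0 ?expR_ge0 // subr_le0 leNgt u_le.
have u_eq k : u k = m.
  have sum0 : \sum_l - tilt m (u l) = 0 by rewrite sumrN sum_tilt oppr0.
  have /eqP := psumr_eq0P (fun l _ => opp_tilt_ge0 l) sum0 (i := k) isT.
  by rewrite oppr_eq0 mulf_eq0 (gt_eqF (expR_gt0 _)) orbF subr_eq0 => /eqP.
by move: uij; rewrite !u_eq eqxx.
Qed.

Lemma is_derive_partition_fun (w : R -> 'I_n -> R) (dw : 'I_n -> R) (t : R) :
  (forall k, is_derive t 1 (w^~ k) (dw k)) ->
  is_derive t 1 (partition_fun \o w) (\sum_k expR (w t k) * dw k).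
Proof.
move=> dwP; have -> : partition_fun \o w = \sum_k (expR \o w^~ k).
  by apply/funext => s; rewrite fct_sumE.
exact: is_derive_sum.
Qed.

Lemma is_derive_gibbs_mean (w : R -> 'I_n -> R) (dw : 'I_n -> R) (t : R) :
  (forall k, is_derive t 1 (w^~ k) (dw k)) ->
  is_derive t 1 (gibbs_mean \o w)
    ((\sum_k (1 + w t k - gibbs_mean (w t)) * expR (w t k) * dw k) /
     partition_fun (w t)).
Proof.
move=> dwP; have Z_gt0 := partition_fun_gt0 (w t).
have dnum : is_derive t 1 (\sum_k (w^~ k * (expR \o w^~ k)))
    (\sum_k (1 + w t k) * expR (w t k) * dw k).
  apply: is_derive_sum => k; apply: is_derive_eq.
  by rewrite /= /GRing.scale /=; ring.
have dinv := is_deriveV (lt0r_neq0 Z_gt0) (is_derive_partition_fun dwP).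
have -> : gibbs_mean \o w = (\sum_k (w^~ k * (expR \o w^~ k))) *
    (fun s => (partition_fun (w s))^-1).
  by apply/funext => s; rewrite /gibbs_mean /= mulrfctE fct_sumE.
apply: is_derive_eq (is_deriveM dnum dinv) _.
rewrite /= /GRing.scale /= fct_sumE /gibbs_mean.
set Z := partition_fun _ in Z_gt0 *; move: (\sum_i _) => W.
rewrite [X in X + _ = _]mulrA !mulr_sumr -big_split mulr_suml /=.
by apply: eq_bigr => k _; field; rewrite gt_eqF.
Qed.

Lemma is_derive_logit_entropy (w : R -> 'I_n -> R) (dw : 'I_n -> R) (t : R) :
  (forall k, is_derive t 1 (w^~ k) (dw k)) ->
  is_derive t 1 (logit_entropy \o w)
    (- (\sum_k tilt (gibbs_mean (w t)) (w t k) * dw k) / partition_fun (w t)).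
Proof.
move=> dwP; have Z_gt0 := partition_fun_gt0 (w t).
have dln := is_derive1_comp (is_derive1_ln Z_gt0) (is_derive_partition_fun dwP).
apply: is_derive_eq (is_deriveB dln (is_derive_gibbs_mean dwP)) _.
rewrite mulr_sumr !mulr_suml -sumrB mulNr mulr_suml -sumrN.
by apply: eq_bigr => k _; rewrite /tilt; field; rewrite gt_eqF.
Qed.

Lemma continuous_partition_fun {T : topologicalType} (f : T -> 'I_n -> R) :
  (forall k, continuous (f^~ k)) -> continuous (partition_fun \o f).
Proof.
move=> fc; apply: (@continuous_big _ _ _ _ _ add_continuous) => k _ x.
by apply: continuous_comp; [exact: fc|exact: continuous_expR].
Qed.

Lemma continuous_gibbs_mean {T : topologicalType} (f : T -> 'I_n -> R) :
  (forall k, continuous (f^~ k)) -> continuous (gibbs_mean \o f).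
Proof.
move=> fc x; apply: cvgM.
  apply: cvg_big => [|k _]; first exact: add_continuous.
  apply: cvgM; first exact: fc.
  by apply: continuous_comp; [exact: fc|exact: continuous_expR].
apply: cvgV; first by rewrite gt_eqF ?partition_fun_gt0.
exact: continuous_partition_fun.
Qed.

Lemma continuous_logit_entropy {T : topologicalType} (f : T -> 'I_n -> R) :
  (forall k, continuous (f^~ k)) -> continuous (logit_entropy \o f).
Proof.
move=> fc x; apply: cvgB; last exact: continuous_gibbs_mean.
apply: continuous_comp; first exact: continuous_partition_fun.
exact/continuous_ln/partition_fun_gt0.
Qed.

Definition plane_rot u i j (t : R) : 'I_n -> R := fun k =>
  if k == i then u i * cos t - u j * sin t
  else if k == j then u i * sin t + u j * cos t else u k.

Lemma plane_rot_fst u i j t : plane_rot u i j t i = u i * cos t - u j * sin t.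
Proof. by rewrite /plane_rot eqxx. Qed.

Lemma plane_rot_snd u i j t :
  i != j -> plane_rot u i j t j = u i * sin t + u j * cos t.
Proof. by rewrite /plane_rot eq_sym eqxx => /negbTE ->. Qed.

Lemma plane_rot_out u i j t k : k != i -> k != j -> plane_rot u i j t k = u k.
Proof. by rewrite /plane_rot => /negbTE -> /negbTE ->. Qed.

Lemma plane_rot0 u i j : plane_rot u i j 0 = u.
Proof.
apply/funext => k; rewrite /plane_rot cos0 sin0 !mulr1 !mulr0 subr0 add0r.
by case: eqP => [->//|_]; case: eqP => [->|].
Qed.

Lemma is_derive_plane_rot u i j (t : R) k : i != j ->
  is_derive t 1 ((plane_rot u i j)^~ k)
    (if k == i then - plane_rot u i j t j
     else if k == j then plane_rot u i j t i else 0).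
Proof.
move=> ij; rewrite plane_rot_fst plane_rot_snd // /plane_rot.
by case: (k == i); last case: (k == j); apply: is_derive_eq;
  rewrite /= /GRing.scale /=; ring.
Qed.

Lemma continuous_plane_rot u i j k : i != j ->
  continuous ((plane_rot u i j)^~ k).
Proof.
move=> ij t; apply/differentiable_continuous/derivable1_diffP.
by have [] := is_derive_plane_rot u t k ij.
Qed.

Lemma sum_plane_rot_sqr u i j (t : R) : i != j ->
  \sum_k plane_rot u i j t k ^+ 2 = \sum_k u k ^+ 2.
Proof.
move=> ij; rewrite !(bigD1 (P := predT) i) //=.
rewrite !(bigD1 (P := fun k => k != i) j) 1?eq_sym //= !addrA; congr (_ + _).
  by rewrite plane_rot_fst plane_rot_snd // -[RHS]mulr1 -(cos2Dsin2 t); ring.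
by apply: eq_bigr => k /andP[ki kj]; rewrite plane_rot_out.
Qed.

Definition plane_rot_slope u i j : R :=
  tilt (gibbs_mean u) (u i) * u j - tilt (gibbs_mean u) (u j) * u i.

Lemma is_derive_logit_entropy_plane_rot u i j (t : R) : i != j ->
  is_derive t 1 (logit_entropy \o plane_rot u i j)
    (plane_rot_slope (plane_rot u i j t) i j /
     partition_fun (plane_rot u i j t)).
Proof.
move=> ij; apply: is_derive_eq.
  by apply: is_derive_logit_entropy => k; exact: is_derive_plane_rot.
congr (_ / _); rewrite (bigD1 i) //= (bigD1 j) 1?eq_sym //= big1 ?addr0.
  by rewrite eqxx [j == i]eq_sym (negbTE ij) eqxx /plane_rot_slope; ring.
by move=> k /andP[/negbTE -> /negbTE ->]; rewrite mulr0.
Qed.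

(* [e^x (1 - m / x) < e^y (1 - m / y)] multiplied by [x y]; the last hypothesis
   covers both [x < y < 0] and [m < x < y]. *)
Lemma tilt_cross_lt m x y : 0 < m -> x < y -> 0 <= (x - m) * y ->
  tilt m x * y < tilt m y * x.
Proof.
move=> m0 xy xmy_ge0; have xmy_lt : (x - m) * y < (y - m) * x by nra.
rewrite /tilt ![_ * expR _ * _]mulrAC.
apply: (@le_lt_trans _ _ ((x - m) * y * expR y)).
  by rewrite ler_wpM2l // ler_expR ltW.
by rewrite ltr_pM2r ?expR_gt0.
Qed.

Lemma plane_rot_slope_lt0 u i j :
  0 < gibbs_mean u -> gibbs_mean u < u i -> u i < u j ->
  plane_rot_slope u i j < 0.
Proof.
move=> m0 mui uij; have uj0 := lt_trans m0 (lt_trans mui uij).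
by rewrite subr_lt0 tilt_cross_lt // mulr_ge0 ?subr_ge0 ?ltW.
Qed.

Definition sphere_minimizer u : Prop := forall w : 'I_n -> R,
  \sum_i w i ^+ 2 = \sum_i u i ^+ 2 -> logit_entropy u <= logit_entropy w.

Lemma exists_sphere_minimizer u0 :
  exists2 u, \sum_i u i ^+ 2 = \sum_i u0 i ^+ 2 & sphere_minimizer u.
Proof.
set r := \sum_i u0 i ^+ 2.
have row_onto w : (\row_i w i : 'rV[R]_n) ord0 = w.
  by apply/funext => i; rewrite mxE.
have [| |v /[!inE] /= vr v_min] := @EVT_min_rV R n
    (logit_entropy \o (fun x : 'rV[R]_n => x ord0)) _ _ (@compact_sphere R n r).
- by exists (\row_i u0 i); rewrite /= row_onto.
- apply/continuous_subspaceT/continuous_logit_entropy => i.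
  exact: coord_continuous.
exists (v ord0) => // w; rewrite vr => wr.
by have := v_min (\row_i w i); rewrite inE /= row_onto => /(_ wr).
Qed.

Lemma sphere_minimizer_stationary u i j : sphere_minimizer u ->
  tilt (gibbs_mean u) (u i) * u j = tilt (gibbs_mean u) (u j) * u i.
Proof.
move=> umin; have [->//|ij] := eqVneq i j.
have dH t := is_derive_logit_entropy_plane_rot u t ij.
have [|t _||t _|_] :=
  @derive1_at_min R (logit_entropy \o plane_rot u i j) (-1) 1 0.
- by lra.
- by have [] := dH t.
- by rewrite in_itv /=; lra.
- by rewrite /= plane_rot0; apply: umin; exact: sum_plane_rot_sqr.
have dH0 := dH 0; rewrite derive_val plane_rot0 => /eqP.
rewrite mulf_eq0 invr_eq0 (gt_eqF (partition_fun_gt0 u)) orbF.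
by rewrite subr_eq0 => /eqP.
Qed.

Lemma sphere_minimizer_eq u i j : sphere_minimizer u ->
  0 < gibbs_mean u -> 0 <= (u i - gibbs_mean u) * u j ->
  0 <= (u j - gibbs_mean u) * u i -> u i = u j.
Proof.
move=> umin m0 uij uji; have [lt_ij|lt_ji|//] := ltgtP (u i) (u j).
- have := tilt_cross_lt m0 lt_ij uij.
  by rewrite sphere_minimizer_stationary ?ltxx.
- have := tilt_cross_lt m0 lt_ji uji.
  by rewrite sphere_minimizer_stationary ?ltxx.
Qed.

Lemma logit_entropy_plane_rot_lt u i j : i != j -> u i = u j ->
  0 < gibbs_mean u -> gibbs_mean u < u i ->
  \forall t \near (0 : R)^'+,
    logit_entropy (plane_rot u i j t) < logit_entropy u.
Proof.
move=> ij uij m0 mui.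
have gibbs_mean_cvg :
    gibbs_mean (plane_rot u i j t) @[t --> 0^'+] --> gibbs_mean u.
  apply: cvg_at_right_filter; rewrite -[in X in _ --> X](plane_rot0 u i j).
  by apply: continuous_gibbs_mean => k; exact: continuous_plane_rot.
have fst_cvg : plane_rot u i j t i @[t --> 0^'+] --> u i.
  apply: cvg_at_right_filter; rewrite -[in X in _ --> X](plane_rot0 u i j).
  exact: continuous_plane_rot.
have <- : logit_entropy (plane_rot u i j 0) = logit_entropy u.
  by rewrite plane_rot0.
apply: (is_derive_lt0_near_right (f := logit_entropy \o plane_rot u i j)).
  by move=> t; exact: is_derive_logit_entropy_plane_rot.
near=> t.
rewrite pmulr_llt0 ?invr_gt0 ?partition_fun_gt0 // plane_rot_slope_lt0 //.
- by near: t; exact: (cvgr_gt (gibbs_mean u)).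
- rewrite -subr_gt0; near: t; apply: (cvgr_gt (u i - gibbs_mean u)).
    exact: cvgB.
  by rewrite subr_gt0.
- have sin_gt0 : 0 < sin t.
    apply: sin2_gt0; apply/andP; split; near: t; first exact: nbhs_right_gt.
    exact: nbhs_right_lt.
  rewrite plane_rot_fst plane_rot_snd // -uij.
  by have := mulr_gt0 (lt_trans m0 mui) sin_gt0; lra.
Unshelve. all: by end_near. Qed.

Lemma sphere_minimizer_le_gibbs_mean u i k : sphere_minimizer u ->
  0 < gibbs_mean u -> gibbs_mean u < u i -> k != i -> u k <= gibbs_mean u.
Proof.
move=> umin m0 mui ki; rewrite leNgt; apply/negP => muk.
have uik : u i = u k.
  have ui0 := lt_trans m0 mui; have uk0 := lt_trans m0 muk.
  by apply: sphere_minimizer_eq => //; rewrite mulr_ge0 // ?subr_ge0 ltW.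
have ik : i != k by rewrite eq_sym.
have [t] := filter_ex (F := nbhs (0 : R)^'+)
  (logit_entropy_plane_rot_lt ik uik m0 mui).
by rewrite ltNge umin // sum_plane_rot_sqr.
Qed.

Lemma sphere_minimizer_lt0 u i k : sphere_minimizer u ->
  0 < gibbs_mean u -> gibbs_mean u < u i -> k != i -> u k < 0.
Proof.
move=> umin m0 mui ki; rewrite ltNge; apply/negP => uk0.
have ui0 : 0 < u i := lt_trans m0 mui.
have stationary := sphere_minimizer_stationary k i umin.
have ukm : u k = gibbs_mean u.
  apply/eqP; rewrite eq_le (sphere_minimizer_le_gibbs_mean umin m0 mui ki) /=.
  have : 0 <= tilt (gibbs_mean u) (u k) * u i.
    by rewrite stationary !mulr_ge0 ?expR_ge0 // subr_ge0 ltW.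
  by rewrite pmulr_lge0 // pmulr_lge0 ?expR_gt0 // subr_ge0.
have : 0 < tilt (gibbs_mean u) (u i) * u k.
  by rewrite !mulr_gt0 ?expR_gt0 ?subr_gt0 ?ukm.
by rewrite -stationary ukm /tilt subrr !mul0r ltxx.
Qed.

Lemma sphere_minimizer_sum u i j : sphere_minimizer u -> u i != u j ->
  \sum_k u k = 0.
Proof.
move=> umin; apply: contraNeq => sum_neq0.
have u_eq l : u l = gibbs_mean u.
  have : \sum_k tilt (gibbs_mean u) (u l) * u k = 0.
    under eq_bigr do rewrite sphere_minimizer_stationary //.
    by rewrite -mulr_suml sum_tilt mul0r.
  rewrite -mulr_sumr => /eqP; rewrite !mulf_eq0 (negbTE sum_neq0) orbF.
  by rewrite (gt_eqF (expR_gt0 _)) orbF subr_eq0 => /eqP.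
by rewrite !u_eq.
Qed.

Lemma sphere_minimizer_spike u i j : sphere_minimizer u -> u i != u j ->
  exists k b, b < u k /\ forall l, l != k -> u l = b.
Proof.
move=> umin uij; have sum0 := sphere_minimizer_sum umin uij.
have m0 : 0 < gibbs_mean u.
  have [ui0|ui_neq0] := eqVneq (u i) 0.
    by apply: (@gibbs_mean_gt0 _ j); rewrite ?sum0 // eq_sym -ui0.
  by apply: (@gibbs_mean_gt0 _ i); rewrite ?sum0.
have [k mk] := exists_gibbs_mean_lt uij.
have lt0 l : l != k -> u l < 0 := sphere_minimizer_lt0 umin m0 mk.
have [l lk] : exists l, l != k.
  have [ik|] := eqVneq i k; last by exists i.
  by exists j; apply: contra_neq uij => ->; rewrite ik.
exists k, (u l); split=> [|l' l'k].
  by rewrite (lt_trans (lt0 _ lk)) // (lt_trans m0).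
have centered_ge0 a b : a != k -> b != k -> 0 <= (u a - gibbs_mean u) * u b.
  move=> /lt0 a0 /lt0 b0; rewrite mulr_le0 // ?subr_le0 ltW //.
  exact: lt_trans a0 m0.
by apply: sphere_minimizer_eq => //; exact: centered_ge0.
Qed.

Lemma sphere_minimizer_entropy_ge u : (1 < n)%N -> sphere_minimizer u ->
  spike_entropy (n%:R - 1)
    (Num.sqrt (\sum_i u i ^+ 2) * Num.sqrt (n%:R / (n%:R - 1)))
  <= logit_entropy u.
Proof.
move=> n1 umin.
have [/forallP u_const|] := boolP [forall i, u i == u i0].
  rewrite (@logit_entropy_spike _ i0 (u i0)) => [|l _]; last exact/eqP.
  rewrite subrr spike_entropy_nonincreasing ?mulr_ge0 //.
  by rewrite subr_ge0 ler1n ltnW.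
rewrite negb_forall => /existsP[i ui].
have [k [b [buk ub]]] := sphere_minimizer_spike umin ui.
rewrite (logit_entropy_spike ub) (spike_gapE n1 _ (ltW buk) ub) //.
exact: sphere_minimizer_sum umin ui.
Qed.

Lemma logit_entropy_ge u : (1 < n)%N ->
  spike_entropy (n%:R - 1)
    (Num.sqrt (\sum_i u i ^+ 2) * Num.sqrt (n%:R / (n%:R - 1)))
  <= logit_entropy u.
Proof.
move=> n1; have [v vu vmin] := exists_sphere_minimizer u.
by rewrite -vu (le_trans (sphere_minimizer_entropy_ge n1 vmin)) ?vmin.
Qed.

End LogitEntropy.

Lemma softmax_entropy_ge (R : realType) (n : nat) (v : 'cV[R]_n) :
  (1 < n)%N ->
  spike_entropy (n%:R - 1) (vnorm2 v * Num.sqrt (n%:R / (n%:R - 1)))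
  <= softmax_entropy v.
Proof.
move=> n1; have i0 : 'I_n := Ordinal (ltnW n1).
by rewrite (softmax_entropyE i0); exact: logit_entropy_ge.
Qed.

Theorem theorem4p2 (R : realType) (D V : nat) (hD : (1 <= D)%N) (hV : (2 <= V)%N)
  (C : 'M[R]_(D, V)) (h : 'cV[R]_D) (sigmaC sigmah : R)
  (hC : spec_norm C = sigmaC)
  (hh : forall i : 'I_D, `|h i ord0| <= sigmah) :
  let rho := sigmaC * sigmah in
  let u := C^T *m h in
  let gamma := expR (- (rho * Num.sqrt ((D * V)%:R / (V%:R - 1)))) in
  softmax_entropy u >=
    ln (1 + (V%:R - 1) * gamma)
    + rho * gamma * Num.sqrt ((D * V)%:R * (V%:R - 1)) / (1 + (V%:R - 1) * gamma).
Proof.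
lazy zeta; set rho := sigmaC * sigmah; set u := C^T *m h; set d := rho * _.
set gamma := expR (- d).
have N_gt0 : 0 < V%:R - 1 :> R by rewrite subr_gt0 ltr1n.
have -> : rho * gamma * Num.sqrt ((D * V)%:R * (V%:R - 1)) =
    (V%:R - 1) * d * gamma by rewrite (sqrtr_mulr_divr _ N_gt0) /d; ring.
have dE : d = rho * Num.sqrt D%:R * Num.sqrt (V%:R / (V%:R - 1)).
  by rewrite /d natrM -[D%:R * _ / _]mulrA [in LHS]sqrtrM ?ler0n // mulrA.
have u_le : vnorm2 u <= rho * Num.sqrt D%:R.
  apply: le_trans (vnorm2_trmx_mulmx_le C h) _.
  rewrite hC /rho -mulrA [sigmah * _]mulrC.
  by rewrite ler_wpM2l ?vnorm2_le_entries // -hC spec_norm_ge0.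
apply: le_trans (softmax_entropy_ge u hV); apply: spike_entropy_nonincreasing.
- exact: ltW.
- by rewrite mulr_ge0 ?sqrtr_ge0 ?vnorm2_ge0.
- by rewrite dE ler_wpM2r ?sqrtr_ge0.
Qed.
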